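(* Let $d\ge 2$ be an integer and let $\mathfrak{F}$ be either an ordered field or a field that has more than two elements, with universe $F$. Let $\mathcal{G}$ be an FFD coordinate geometry over $\mathfrak{F}$ (of dimension $d$), and let $\mathsf{R}\subseteq (F^d)^n$ be an $n$-ary relation on the points $F^d$, for some $n\ge 1$. Then the following statements are equivalent: (i) $\mathsf{R}$ is a concept of $\mathcal{G}$, i.e. $\mathsf{R}$ is definable in $\mathcal{G}$; (ii) $\mathsf{R}$ is definable over $\mathfrak{F}$ and is closed under all automorphisms of $\mathcal{G}$; (iii) $\mathsf{R}$ is definable over $\mathfrak{F}$ and is closed under all affine automorphisms of $\mathcal{G}$.
   Context: A field is $\langle F,+,\cdot,0,1\rangle$; an ordered field is $\langle F,+,\cdot,0,1,\le\rangle$. ''Definable'' always means first-order definable without parameters: an $n$-ary relation $\mathsf{S}$ on the universe $M$ of a model $\mathfrak{M}$ is definable in $\mathfrak{M}$ iff there is a formula $\varphi(v_1,\dots,v_n)$ of the language of $\mathfrak{M}$ with $(a_1,\dots,a_n)\in\mathsf{S}\iff \mathfrak{M}\models\varphi[a_1,\dots,a_n]$; definable relations are called concepts of $\mathfrak{M}$. For $\vec p=\langle p_1,\dots,p_d\rangle\in F^d$, the collinearity relation is ${\mathsf{Col}}(\vec p,\vec q,\vec r)$ iff $\vec q=\vec p+\lambda(\vec r-\vec p)$ for some $\lambda\in F$ or $\vec r=\vec p$; for an ordered field, the betweenness relation is ${\mathsf{Bw}}(\vec p,\vec q,\vec r)$ iff $\vec q=\vec p+\lambda(\vec r-\vec p)$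 for some $\lambda\in F$ with $0\le\lambda\le 1$. An $n$-ary relation $\mathsf{R}$ on $F^d$ is definable over $\mathfrak{F}$ iff the $dn$-ary relation $\widehat{\mathsf{R}}=\{(p_{11},\dots,p_{1d},\dots,p_{n1},\dots,p_{nd}) : (\langle p_{11},\dots,p_{1d}\rangle,\dots,\langle p_{n1},\dots,p_{nd}\rangle)\in\mathsf{R}\}$ on $F$ is definable in $\mathfrak{F}$. A ($d$-dimensional) coordinate geometry over a field $\mathfrak{F}$ is a first-order model $\mathcal{G}$ whose universe is $F^d$, whose language contains only relation symbols (no functions or constants), and in which ${\mathsf{Col}}$ is definable. A coordinate geometry over an ordered field $\mathfrak{F}$ is defined the same way, with ${\mathsf{Bw}}$ in place of ${\mathsf{Col}}$. A coordinate geometry is field-definable if all its relations are definable over $\mathfrak{F}$, and FFD (finitely field-definable) if it is field-definable and has only finitely many relations. An affine transformation of $F^d$ is a map $\tau\circ L$ with $L$ an invertible linear map $F^d\to F^d$ and $\tau$ a translation. An affine automorphism of $\mathcal{G}$ is an automorphism of $\mathcal{G}$ that is an affine transformation. A relation $\mathsf{R}$ is closed under $f$ if $(a_1,\dots,a_n)\in\mathsf{R}$ implies $(f(a_1),\dots,f(a_n))\in\mathsf{R}$. *)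

(* Defs.v *)
From HB Require Import structures.
From mathcomp Require Import all_boot all_order all_algebra.
Set Implicit Arguments. Unset Strict Implicit. Unset Printing Implicit Defensive.
Import Order.TTheory GRing.Theory Num.Theory.
Local Open Scope ring_scope.

Record sig := Sig {
  fsym : Type; fari : fsym -> nat;
  rsym : Type; rari : rsym -> nat }.

Record structure (L : sig) (M : Type) := Structure {
  fint : forall f : fsym L, ('I_(fari f) -> M) -> M;
  rint : forall r : rsym L, ('I_(rari r) -> M) -> Prop }.
Arguments fint {L M} s f _.
Arguments rint {L M} s r _.

(* Terms: variables v_i (i : nat) and function applications.
   No constants from M: definability is parameter-free. *)
Inductive term (L : sig) :=
| TVar (i : nat)
| TApp (f : fsym L) (args : 'I_(fari f) -> term L).

Inductive formula (L : sig) :=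
| FEq (t1 t2 : term L)
| FRel (r : rsym L) (args : 'I_(rari r) -> term L)
| FNot (p : formula L)
| FAnd (p q : formula L)
| FOr (p q : formula L)
| FImp (p q : formula L)
| FEx (i : nat) (p : formula L)
| FAll (i : nat) (p : formula L).

Section Semantics.
Variables (L : sig) (M : Type) (S : structure L M).

Fixpoint eval (e : nat -> M) (t : term L) : M :=
  match t with
  | TVar i => e i
  | TApp f a => @fint L M S f (fun k => eval e (a k))
  end.

Definition upd (e : nat -> M) (i : nat) (x : M) : nat -> M :=
  fun j => if j == i then x else e j.

Fixpoint sat (e : nat -> M) (p : formula L) : Prop :=
  match p with
  | FEq t1 t2 => eval e t1 = eval e t2
  | FRel r a => @rint L M S r (fun k => eval e (a k))
  | FNot p => ~ sat e p
  | FAnd p q => sat e p /\ sat e q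
  | FOr p q => sat e p \/ sat e q
  | FImp p q => sat e p -> sat e q
  | FEx i p => exists x, sat (upd e i x) p
  | FAll i p => forall x, sat (upd e i x) p
  end.

(* An n-ary relation R on M is definable (without parameters) in S iff some
   formula phi(v_0,...,v_{n-1}) defines it: (a_0..a_{n-1}) in R iff
   S |= phi[a_0..a_{n-1}].  Quantifying over all assignments e forces the
   truth of phi to depend only on v_0..v_{n-1}. *)
Definition definable (n : nat) (R : ('I_n -> M) -> Prop) : Prop :=
  exists p : formula L, forall e : nat -> M,
    R (fun i : 'I_n => e (nat_of_ord i)) <-> sat e p.

Definition automorphism (f : M -> M) : Prop :=
  bijective f /\
  (forall (g : fsym L) (a : 'I_(fari g) -> M), f (@fint L M S g a) = @fint L M S g (f \o a)) /\
  (forall (r : rsym L) (a : 'I_(rari r) -> M), @rint L M S r a <-> @rint L M S r (f \o a)).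

End Semantics.
Arguments definable {L M} S n R.
Arguments automorphism {L M} S f.

Definition closed_under (M : Type) (n : nat) (R : ('I_n -> M) -> Prop)
  (f : M -> M) : Prop := forall a, R a -> R (f \o a).

Definition finitely_many_rels (L : sig) : Prop :=
  exists (k : nat) (g : 'I_k -> rsym L), forall r, exists i, g i = r.

Definition relational (L : sig) : Prop := fsym L -> False.

Inductive field_fsym := FAdd | FMul | FZero | FOne.
Definition field_fari (f : field_fsym) : nat :=
  match f with FAdd => 2 | FMul => 2 | FZero => 0 | FOne => 0 end.

Definition field_sig : sig := @Sig field_fsym field_fari Empty_set (fun _ => 0%N).
Definition ofield_sig : sig := @Sig field_fsym field_fari unit (fun _ => 2%N).

Definition field_fint (F : pzRingType) (f : field_fsym) :
  ('I_(field_fari f) -> F) -> F :=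
  match f return ('I_(field_fari f) -> F) -> F with
  | FAdd => fun a => a ord0 + a ord_max
  | FMul => fun a => a ord0 * a ord_max
  | FZero => fun _ => 0
  | FOne => fun _ => 1
  end.

Definition field_struct (F : fieldType) : structure field_sig F :=
  @Structure field_sig F (@field_fint F)
    (fun (r : Empty_set) _ => match r with end).

Definition ofield_struct (F : realFieldType) : structure ofield_sig F :=
  @Structure ofield_sig F (@field_fint F)
    (fun (r : unit) (a : 'I_2 -> F) => a ord0 <= a ord_max).

Lemma flat_lt (n d : nat) (i : 'I_n) (j : 'I_d) : (i * d + j < n * d)%N.
Proof.
apply: (@leq_trans (i * d + d)); first by rewrite ltn_add2l.
by rewrite -mulSnr leq_mul2r ltn_ord orbT.
Qed.

(* index of coordinate p_{ij} in (p_11,...,p_1d,...,p_n1,...,p_nd) *)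
Definition flat (n d : nat) (i : 'I_n) (j : 'I_d) : 'I_(n * d)%N :=
  Ordinal (flat_lt i j).

Definition hat (F : Type) (d n : nat) (R : ('I_n -> 'rV[F]_d) -> Prop) :
  ('I_(n * d)%N -> F) -> Prop :=
  fun x => R (fun i => \row_(j < d) x (flat i j)).

Definition definable_over (LB : sig) (F : Type) (B : structure LB F)
  (d n : nat) (R : ('I_n -> 'rV[F]_d) -> Prop) : Prop :=
  @definable LB F B (n * d)%N (hat R).

Definition Col (F : fieldType) (d : nat) (a : 'I_3 -> 'rV[F]_d) : Prop :=
  let p := a ord0 in let q := a (inord 1) in let r := a ord_max in
  (exists l : F, q = p + l *: (r - p)) \/ r = p.

Definition Bw (F : realFieldType) (d : nat) (a : 'I_3 -> 'rV[F]_d) : Prop :=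
  let p := a ord0 in let q := a (inord 1) in let r := a ord_max in
  exists l : F, 0 <= l <= 1 /\ q = p + l *: (r - p).

Definition affine (F : fieldType) (d : nat) (f : 'rV[F]_d -> 'rV[F]_d) : Prop :=
  exists (A : 'M[F]_d) (t : 'rV[F]_d), A \in unitmx /\ forall x, f x = x *m A + t.

(* G is a coordinate geometry over B (with basic relation K = Col or Bw):
   universe F^d, only relation symbols, and K definable in G. *)
Definition coord_geometry (LB : sig) (F : Type) (B : structure LB F) (d : nat)
  (K : ('I_3 -> 'rV[F]_d) -> Prop) (LG : sig) (G : structure LG 'rV[F]_d) : Prop :=
  relational LG /\ definable G 3 K.

Definition FFD (LB : sig) (F : Type) (B : structure LB F) (d : nat)
  (K : ('I_3 -> 'rV[F]_d) -> Prop) (LG : sig) (G : structure LG 'rV[F]_d) : Prop :=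
  [/\ coord_geometry B K G,
      forall r : rsym LG, definable_over B (rint G r)
    & finitely_many_rels LG].

Definition concept_equivalences (LB : sig) (F : fieldType) (B : structure LB F)
  (d : nat) (LG : sig) (G : structure LG 'rV[F]_d) (n : nat)
  (R : ('I_n -> 'rV[F]_d) -> Prop) : Prop :=
  (definable G n R <->
     definable_over B R /\ forall f, automorphism G f -> closed_under R f) /\
  (definable G n R <->
     definable_over B R /\ forall f, automorphism G f -> affine f -> closed_under R f).

(* Main.v *)
(** A formula of [G] becomes a formula over the field by replacing each point
    variable with [d] coordinate variables, so concepts are field-definable, and
    they are preserved by automorphisms.

    Conversely, for an affine frame [f] the field operations live on the first axis
    of [f] and the coordinates of a point along [f] can be read off there, all of it
    by constructions that use collinearity only. Hence for a field-definable [R] the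
    transported relation [R^f] (the image of [R] under the affine map [g_f] sending
    the standard frame to [f]) is definable in [G] with [f] as parameter. If [R] is
    closed under affine automorphisms, then [R x] holds iff there is a frame [f] with
    [S^f = S] for each of the finitely many relations [S] of [G], and [R^f x]: the
    first condition says precisely that [g_f] is an automorphism of [G], and the
    standard frame is one such [f]. The fundamental theorem of affine geometry is
    not involved. *)

Require Import Defs.
From HB Require Import structures.
From mathcomp Require Import all_boot all_order all_algebra boolp.
From mathcomp Require Import ring lra.
Set Implicit Arguments. Unset Strict Implicit. Unset Printing Implicit Defensive.
Import Order.TTheory GRing.Theory Num.Theory.
Local Open Scope ring_scope.

(** * Renaming of variables in formulas *)

Section Renaming.
Variables (L : sig) (M : Type) (S : structure L M).
Implicit Types (p q : formula L) (e : nat -> M).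

Lemma sat_ext e e' p : e =1 e' -> sat S e p <-> sat S e' p.
Proof. by move=> /funext ->. Qed.

Lemma eval_local (t : term L) : exists N, forall e e',
  (forall k, (k < N)%N -> e k = e' k) -> eval S e t = eval S e' t.
Proof.
elim: t => [i|g a IH]; first by exists i.+1 => e e'; apply.
have [N HN] := fin_all_exists IH.
exists (\max_i N i) => e e' ee' /=; congr fint; apply: funext => k.
by apply: HN => j jN; apply/ee'/(leq_trans jN)/leq_bigmax.
Qed.

(** Arities are finite, so a formula mentions finitely many variables. The bound [N] is what makes a
    fresh variable available in [sat_ren]. *)
Lemma sat_local p : exists N, forall e e',
  (forall k, (k < N)%N -> e k = e' k) -> sat S e p <-> sat S e' p.
Proof.
have two (P Q : (nat -> M) -> (nat -> M) -> Prop) :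
    (exists N, forall e e', (forall k, (k < N)%N -> e k = e' k) -> P e e') ->
    (exists N, forall e e', (forall k, (k < N)%N -> e k = e' k) -> Q e e') ->
    exists N, forall e e', (forall k, (k < N)%N -> e k = e' k) ->
      P e e' /\ Q e e'.
  move=> [N1 H1] [N2 H2]; exists (maxn N1 N2) => e e' ee'.
  by split; [apply: H1|apply: H2] => k kN; apply: ee'; rewrite leq_max kN ?orbT.
have updN i p' N (H : forall e e', (forall k, (k < N)%N -> e k = e' k) ->
    sat S e p' <-> sat S e' p') e e' x :
    (forall k, (k < N)%N -> e k = e' k) ->
    sat S (upd e i x) p' <-> sat S (upd e' i x) p'.
  by move=> ee'; apply: H => k kN; rewrite /upd; case: eqP => // _; apply: ee'.
elim: p => [t1 t2|r a|p [N H]|p IHp q IHq|p IHp q IHq|p IHp q IHq|i p [N H]|i p [N H]] /=.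
- have [N H] := two _ _ (eval_local t1) (eval_local t2).
  by exists N => e e' /H[-> ->].
- have [N HN] := fin_all_exists (fun k => eval_local (a k)).
  exists (\max_i N i) => e e' ee'.
  have -> // : (fun k => eval S e (a k)) = (fun k => eval S e' (a k)).
  apply: funext => k.
  by apply: HN => j jN; apply/ee'/(leq_trans jN)/leq_bigmax.
- by exists N => e e' /H ->.
- by have [N H] := two _ _ IHp IHq; exists N => e e' /H[-> ->].
- by have [N H] := two _ _ IHp IHq; exists N => e e' /H[-> ->].
- by have [N H] := two _ _ IHp IHq; exists N => e e' /H[-> ->].
- exists N => e e' ee'.
  by split=> -[x Hx]; exists x; move: Hx; rewrite (updN i p N H _ _ x ee').
- exists N => e e' ee'.
  by split=> Hx x; move: (Hx x); rewrite (updN i p N H _ _ x ee').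
Qed.

Lemma eval_ren (t : term L) (s : nat -> nat) :
  exists t', forall e, eval S e t' = eval S (e \o s) t.
Proof.
elim: t => [i|g a IH]; first by exists (TVar L (s i)).
have [a' Ha'] := fin_all_exists IH.
exists (TApp a') => e /=; congr fint.
by apply: funext => k.
Qed.

(** [s] is arbitrary, so a bound variable could be captured. Each quantifier is therefore moved to
    an index larger than all values of [s] below the bound of [sat_local]. *)
Lemma sat_ren p : forall s : nat -> nat,
  exists q, forall e, sat S e q <-> sat S (e \o s) p.
Proof.
have fresh s i p' : exists j, forall e x (s' := fun k => if k == i then j else s k),
    sat S (upd e j x \o s') p' <-> sat S (upd (e \o s) i x) p'.
  have [N HN] := sat_local p'.
  exists (\max_(k < N) s k).+1 => e x s'; apply: HN => k kN.
  rewrite /= /upd /s'; case: (k == i); first by rewrite eqxx.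
  rewrite ltn_eqF // ltnS.
  exact: (@leq_bigmax _ (fun k : 'I_N => s k) (Ordinal kN)).
elim: p => [t1 t2|r a|p IH|p IHp q IHq|p IHp q IHq|p IHp q IHq|i p IH|i p IH] s.
- have [t1' H1] := eval_ren t1 s; have [t2' H2] := eval_ren t2 s.
  by exists (FEq t1' t2') => e /=; rewrite H1 H2.
- have [a' Ha'] := fin_all_exists (fun k => eval_ren (a k) s).
  exists (FRel a') => e /=.
  have -> // : (fun k => eval S e (a' k)) = (fun k => eval S (e \o s) (a k)).
  exact: funext.
- by have [p' Hp] := IH s; exists (FNot p') => e /=; rewrite Hp.
- have [p' Hp] := IHp s; have [q' Hq] := IHq s.
  by exists (FAnd p' q') => e /=; rewrite Hp Hq.
- have [p' Hp] := IHp s; have [q' Hq] := IHq s.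
  by exists (FOr p' q') => e /=; rewrite Hp Hq.
- have [p' Hp] := IHp s; have [q' Hq] := IHq s.
  by exists (FImp p' q') => e /=; rewrite Hp Hq.
- have [j Hj] := fresh s i p.
  have [p' Hp] := IH (fun k => if k == i then j else s k).
  by exists (FEx j p') => e /=; split=> -[x Hx]; exists x; move: Hx; rewrite Hp Hj.
- have [j Hj] := fresh s i p.
  have [p' Hp] := IH (fun k => if k == i then j else s k).
  by exists (FAll j p') => e /=; split=> Hx x; move: (Hx x); rewrite Hp Hj.
Qed.

End Renaming.

(** * Definable predicates *)

(** Variables are functions of an abstract environment rather than indices, so that
    predicates are written as Rocq propositions and binders never rename anything. *)
Record ctx (M : Type) := Ctx {
  env : Type;
  var : (env -> M) -> Prop;
  var_inhabited : exists x, var x }.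
Arguments var {M} c _.

Definition ctx_base M : ctx M :=
  @Ctx M (nat -> M) (fun x => exists i, forall e, x e = e i)
    (ex_intro _ (fun e => e 0%N) (ex_intro _ 0%N (fun e => erefl))).

(** [T] is the type of the bound object and [pr] gives its components, so that binding one element
    and binding a tuple share one construction. *)
Definition ext_var M (C : ctx M) (T : Type) (I : Type) (pr : T -> I -> M)
    (x : env C * T -> M) : Prop :=
  (exists2 y, (forall e t, x (e, t) = y e) & var C y) \/
  (exists i, forall e t, x (e, t) = pr t i).

Lemma ext_var_inhabited M (C : ctx M) T I (pr : T -> I -> M) :
  exists x, @ext_var M C T I pr x.
Proof.
by have [x xV] := var_inhabited C; exists (fun em => x em.1); left; exists x.
Qed.

Definition ctx1 M (C : ctx M) : ctx M :=
  Ctx (ext_var_inhabited C (fun (m : M) (_ : unit) => m)).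

Definition ctxn M (C : ctx M) (n : nat) : ctx M :=
  Ctx (ext_var_inhabited C (fun (m : 'I_n -> M) i => m i)).

Section Definability.
Variables (L : sig) (M : Type) (S : structure L M).

(** Since [v] may read several indices as the same variable, identifying variables never changes the
    formula. *)
Definition dfn (C : ctx M) (P : env C -> Prop) : Prop :=
  exists (p : formula L) (v : nat -> env C -> M),
    (forall k, var C (v k)) /\ forall e, P e <-> sat S (fun k => v k e) p.

Implicit Types C : ctx M.

Lemma dfn_iff C P Q : (forall e : env C, P e <-> Q e) -> dfn Q -> dfn P.
Proof.
by move=> PQ [p [v [vV pE]]]; exists p, v; split=> // e; rewrite PQ.
Qed.

Lemma dfn_sub C C' (h : env C' -> env C) P :
  (forall x, var C x -> var C' (x \o h)) -> dfn P -> dfn (P \o h).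
Proof.
move=> hV [p [v [vV pE]]]; exists p, (fun k => v k \o h); split=> [k|e].
  exact: hV.
exact: pE.
Qed.

(** The way back to [definable]: variables of the base context are projections, so the reading of
    the indices is a mere renaming, which [sat_ren] absorbs. *)
Lemma dfn_baseE P : @dfn (ctx_base M) P -> exists p, forall e, P e <-> sat S e p.
Proof.
move=> [p [v [/choice[s sE] pE]]]; have [q qE] := sat_ren S p s.
by exists q => e; rewrite pE qE; apply: sat_ext => k /=; apply: sE.
Qed.

Lemma dfn_not C P : @dfn C P -> @dfn C (fun e => ~ P e).
Proof.
by move=> [p [v [vV pE]]]; exists (FNot p), v; split=> // e; rewrite /= pE.
Qed.

(** The two formulas may read the same index differently, so their indices are moved to the even and
    to the odd numbers. *)
Lemma common_vars C P Q : @dfn C P -> @dfn C Q -> exists (p q : formula L) v,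
  [/\ forall k, var C (v k), forall e, P e <-> sat S (fun k => v k e) p
    & forall e, Q e <-> sat S (fun k => v k e) q].
Proof.
move=> [p [v [vV pE]]] [q [w [wV qE]]].
have [p' p'E] := sat_ren S p (fun k => k.*2).
have [q' q'E] := sat_ren S q (fun k => k.*2.+1).
exists p', q', (fun k => if odd k then w k./2 else v k./2); split.
- by move=> k; case: odd.
- move=> e; rewrite pE p'E; apply: sat_ext => k /=.
  by rewrite odd_double doubleK.
- move=> e; rewrite qE q'E; apply: sat_ext => k /=.
  by rewrite odd_double /= uphalf_double.
Qed.

Lemma dfn_and C P Q : @dfn C P -> @dfn C Q -> @dfn C (fun e => P e /\ Q e).
Proof.
move=> dP dQ; have [p [q [v [vV pE qE]]]] := common_vars dP dQ.
by exists (FAnd p q), v; split=> // e; rewrite /= pE qE.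
Qed.

Lemma dfn_or C P Q : @dfn C P -> @dfn C Q -> @dfn C (fun e => P e \/ Q e).
Proof.
move=> dP dQ; have [p [q [v [vV pE qE]]]] := common_vars dP dQ.
by exists (FOr p q), v; split=> // e; rewrite /= pE qE.
Qed.

Lemma dfn_and3 C P Q R : @dfn C P -> @dfn C Q -> @dfn C R ->
  @dfn C (fun e => [/\ P e, Q e & R e]).
Proof.
move=> dP dQ dR; apply: (@dfn_iff _ _ (fun e => P e /\ Q e /\ R e)) => [e|].
  by split=> [[]|[? []]].
by do 2!apply: dfn_and => //.
Qed.

Lemma dfn_and4 C P Q R T : @dfn C P -> @dfn C Q -> @dfn C R -> @dfn C T ->
  @dfn C (fun e => [/\ P e, Q e, R e & T e]).
Proof.
move=> dP dQ dR dT; apply: (@dfn_iff _ _ (fun e => P e /\ [/\ Q e, R e & T e])) => [e|].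
  by split=> [[]|[? []]].
by apply: dfn_and => //; apply: dfn_and3.
Qed.

Lemma dfn_or3 C P Q R : @dfn C P -> @dfn C Q -> @dfn C R ->
  @dfn C (fun e => [\/ P e, Q e | R e]).
Proof.
move=> dP dQ dR; apply: (@dfn_iff _ _ (fun e => P e \/ Q e \/ R e)) => [e|].
  by split=> [[]|[|[]]]; [left|right; left|right; right|constructor 1|constructor 2|constructor 3].
by do 2!apply: dfn_or => //.
Qed.

Lemma dfn_imp C P Q : @dfn C P -> @dfn C Q -> @dfn C (fun e => P e -> Q e).
Proof.
move=> dP dQ; have [p [q [v [vV pE qE]]]] := common_vars dP dQ.
by exists (FImp p q), v; split=> // e; rewrite /= pE qE.
Qed.

Lemma dfn_equiv C P Q : @dfn C P -> @dfn C Q -> @dfn C (fun e => P e <-> Q e).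
Proof. by move=> dP dQ; apply: dfn_and; apply: dfn_imp. Qed.

Lemma dfn_eq C x y : var C x -> var C y -> dfn (fun e => x e = y e).
Proof.
move=> xV yV; exists (FEq (TVar L 0) (TVar L 1)).
by exists (fun k => if k is 0%N then x else y); split=> // -[].
Qed.

Lemma dfn_true C : dfn (fun _ : env C => True).
Proof.
have [x xV] := var_inhabited C.
by apply: (@dfn_iff _ _ (fun e => x e = x e)) => //; apply: dfn_eq.
Qed.

Lemma dfn_ex C (P : env C -> M -> Prop) :
  @dfn (ctx1 C) (fun em => P em.1 em.2) -> dfn (fun e => exists m, P e m).
Proof.
move=> [p [v [vV pE]]]; have [x0 x0V] := var_inhabited C.
(* [None] marks the indices read as the bound element. They are renamed to 0, the index that [FEx]
   will bind, and all others are shifted up by one. *)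
have /choice[w wE] k : exists y : option (env C -> M),
    (forall x, y = Some x -> var C x) /\
    (forall e m, v k (e, m) = if y is Some x then x e else m).
  case: (vV k) => [[y yE yV]|[_ yE]]; last by exists None.
  by exists (Some y); split=> // x [<-].
have [q qE] := sat_ren S p (fun k => if w k is Some _ then k.+1 else 0%N).
exists (FEx 0 q), (fun k => if k is k'.+1 then odflt x0 (w k') else x0).
split=> [[|k] //|e].
  by case Ek: (w k) => [y|] //=; apply: (wE k).1.
have vw m k : v k (e, m) = upd (fun k => (if k is k'.+1 then odflt x0 (w k') else x0) e) 0 m
    (if w k is Some _ then k.+1 else 0%N).
  by rewrite (wE k).2 /upd; case E: (w k) => [y|] /=; rewrite ?E ?eqxx.
rewrite /=; split=> -[m]; [move=> Pm|rewrite qE => Pm]; exists m.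
  by rewrite qE; move/(pE (e, m)): Pm; rewrite (sat_ext S p (vw m)).
by apply/(pE (e, m)); rewrite (sat_ext S p (vw m)).
Qed.

(** A tuple is bound one entry at a time, head first, and [dfn_sub] regroups the environment
    accordingly. *)
Lemma dfn_exn C n (P : env C -> ('I_n -> M) -> Prop) :
  @dfn (ctxn C n) (fun em => P em.1 em.2) -> dfn (fun e => exists m, P e m).
Proof.
elim: n C P => [|n IH] C P dP.
  pose z (i : 'I_0) : M := False_rect _ (notF (ltn_ord i)).
  apply: (@dfn_iff _ _ (fun e => P e z)) => [e|].
    split=> [[m]|Pz]; last by exists z.
    by have -> // : m = z by apply: funext => -[].
  apply: (dfn_sub (C := ctxn C 0) (h := fun e => (e, z))) dP => x [[y yE yV]|[[]//]].
  by have -> : x \o (fun e => (e, z)) = y by apply: funext => e; rewrite /= yE.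
pose cons (x : M) (m : 'I_n -> M) (i : 'I_n.+1) :=
  if unlift ord0 i is Some j then m j else x.
apply: (@dfn_iff _ _ (fun e => exists x m, P e (cons x m))) => [e|].
  split=> [[m Pm]|[x [m Pm]]]; last by exists (cons x m).
  exists (m ord0), (fun j => m (lift ord0 j)).
  have -> // : cons (m ord0) (fun j => m (lift ord0 j)) = m.
  by apply: funext => i; rewrite /cons; case: unliftP => [j|] ->.
apply: dfn_ex; apply: IH.
apply: (dfn_sub (C := ctxn C n.+1) (C' := ctxn (ctx1 C) n)
  (h := fun em => (em.1.1, cons em.1.2 em.2))) dP => x [[y yE yV]|[i xE]].
  by left; exists (fun em => y em.1) => [[e m] t /=|]; [rewrite yE|left; exists y].
case: (unliftP ord0 i) => [j|] Ei.
  by right; exists j => -[e m] t /=; rewrite xE Ei /cons liftK.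
left; exists snd => [[e m] t /=|]; last by right; exists tt.
by rewrite xE Ei /cons unlift_none.
Qed.

Lemma dfn_all C (P : env C -> M -> Prop) :
  @dfn (ctx1 C) (fun em => P em.1 em.2) -> dfn (fun e => forall m, P e m).
Proof.
move=> dP; apply: (@dfn_iff _ _ (fun e => ~ exists m, ~ P e m)) => [e|].
  by rewrite -forallNE; split=> H m; [rewrite notK|apply: contrapT].
by apply/dfn_not/dfn_ex/dfn_not.
Qed.

Lemma dfn_alln C n (P : env C -> ('I_n -> M) -> Prop) :
  @dfn (ctxn C n) (fun em => P em.1 em.2) -> dfn (fun e => forall m, P e m).
Proof.
move=> dP; apply: (@dfn_iff _ _ (fun e => ~ exists m, ~ P e m)) => [e|].
  by rewrite -forallNE; split=> H m; [rewrite notK|apply: contrapT].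
by apply/dfn_not/dfn_exn/dfn_not.
Qed.

Lemma dfn_forall_ord C n (P : 'I_n -> env C -> Prop) :
  (forall i, dfn (P i)) -> dfn (fun e => forall i, P i e).
Proof.
elim: n P => [|n IH] P dP.
  by apply: (@dfn_iff _ _ (fun=> True)) => [e|]; [split=> // _ []|apply: dfn_true].
apply: (@dfn_iff _ _ (fun e => P ord0 e /\ forall i, P (lift ord0 i) e)) => [e|].
  split=> [H|[H0 H] i]; first by split.
  by case: (unliftP ord0 i) => [j|] ->.
by apply: dfn_and => //; apply: IH.
Qed.

Lemma dfn_rint C (r : rsym L) (x : env C -> 'I_(rari r) -> M) :
  (forall i, var C (fun e => x e i)) -> dfn (fun e => rint S r (x e)).
Proof.
move=> xV; have [x0 x0V] := var_inhabited C.
exists (FRel (fun i : 'I_(rari r) => TVar L i)).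
exists (fun k e => if insub k is Some i then x e i else x0 e); split=> [k|e /=].
  by case: insub.
have -> // : (fun i : 'I_(rari r) =>
    (if insub (val i) is Some j then x e j else x0 e)) = x e.
by apply: funext => i; rewrite valK.
Qed.

Lemma dfn_definable C n (R : ('I_n -> M) -> Prop) (x : env C -> 'I_n -> M) :
  definable S n R -> (forall i, var C (fun e => x e i)) -> dfn (fun e => R (x e)).
Proof.
move=> [p pE] xV; have [x0 x0V] := var_inhabited C.
(* [p] may mention indices from [n] on, but its truth does not depend on their values, so any
   variable serves as filler. *)
exists p, (fun k e => if insub k is Some i then x e i else x0 e); split=> [k|e /=].
  by case: insub.
rewrite -pE; have -> // : (fun i : 'I_n =>
    (if insub (val i) is Some j then x e j else x0 e)) = x e.
by apply: funext => i; rewrite valK.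
Qed.

End Definability.

Ltac solve_var :=
  cbv beta;
  solve [ assumption
        | match goal with H : forall i, var _ _ |- _ => apply: H end
        | left; eexists; [ by move=> ? ? /=; reflexivity | solve_var ]
        | right; exists tt; by []
        | right; eexists; by move=> ? ? /=; reflexivity ].

Ltac coordinatewise := apply/rowP => ?; rewrite !mxE.

(** * Affine geometry from collinearity *)

Section AffineGeometry.
Variables (F : fieldType) (d : nat).
Local Notation pt := 'rV[F]_d.+2.
Implicit Types (a b c p q x y z w : pt) (s t l : F).

Definition collinear p q r : Prop := (exists l, q = p + l *: (r - p)) \/ r = p.

(** This also excludes [b = a], because [collinear] holds whenever its outer points coincide. *)
Definition indep a b c : Prop := ~ collinear a c b.

(** A nonzero coefficient of [c - a] could be divided out, which would put [c] on the line [ab]. *)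
Lemma indepP a b c : indep a b c <->
  forall s t, s *: (b - a) + t *: (c - a) = 0 -> s = 0 /\ t = 0.
Proof.
split=> [abc s t st0|ind [[l cE]|bE]].
- have t0 : t = 0.
    apply: contra_notP abc => /eqP t0; left; exists (- s / t).
    have /rowP st0' := st0; apply/rowP => j; move: (st0' j); rewrite !mxE => E.
    apply: (mulfI t0); apply/eqP; rewrite -subr_eq0 -E; apply/eqP; by field.
  move/eqP: st0; rewrite t0 scale0r addr0 scaler_eq0 => /orP[/eqP-> //|].
  by rewrite subr_eq0 => /eqP bE; case: abc; right.
- have [_ /eqP] : - l = 0 /\ (1 : F) = 0 by apply: ind; rewrite cE; coordinatewise; ring.
  by rewrite oner_eq0.
- have [/eqP] : (1 : F) = 0 /\ (0 : F) = 0 by apply: ind; rewrite bE; coordinatewise; ring.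
  by rewrite oner_eq0.
Qed.

Lemma indepC a b c : indep a b c -> indep a c b.
Proof.
move=> /indepP ind; apply/indepP => s t E.
by have [] := ind t s; rewrite // addrC.
Qed.

Lemma indep_neq a b c : indep a b c -> a <> b.
Proof. by move=> abc ab; apply: abc; right. Qed.

(** Here the dimension is at least 2: [b - a] is nonzero in some coordinate [i], and [a] is moved in
    another coordinate [j]. On the line [ab], keeping coordinate [i] fixed would force the parameter
    0. *)
Lemma exists_indep a b : a <> b -> exists c, indep a b c.
Proof.
move=> ab.
have [i bi] : exists i, (b - a) 0 i != 0.
  apply/not_existsP => H; apply: ab; apply/esym/eqP; rewrite -subr_eq0; apply/eqP.
  by apply/rowP => i; rewrite [RHS]mxE; apply/eqP; apply: contrapT => /negP /H.
pose j : 'I_d.+2 := if i == ord0 then ord_max else ord0.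
have ij : i == j = false by rewrite /j; case: (eqVneq i ord0) => [->|/negPf].
exists (a + delta_mx 0 j); case=> [[l /addrI E]|/esym //].
have := congr1 (fun v : 'rV_d.+2 => v 0 i) E.
rewrite [LHS]mxE ij andbF [RHS]mxE => /esym/eqP.
rewrite mulf_eq0 (negPf bi) orbF => /eqP l0.
have := congr1 (fun v : 'rV_d.+2 => v 0 j) E.
by rewrite l0 scale0r !mxE !eqxx => /eqP; rewrite oner_eq0.
Qed.

(** Covers the whole plane [abc] because the field has more than two elements. *)
Definition coplanar a b c e : Prop :=
  exists p q, [/\ collinear a p b, collinear a q c, p <> q & collinear p e q].

(** [c <> e] and the line [ce] is parallel to the line [ab]; meaningful only when
    [c] is off the line [ab]. *)
Definition linepar a b c e : Prop :=
  [/\ e <> c, coplanar a b c e & ~ exists x, collinear a x b /\ collinear c x e].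

Hypothesis F_gt2 : exists l : F, l != 0 /\ l != 1.

Lemma lineparP a b c e : indep a b c ->
  linepar a b c e <-> exists2 t, t != 0 & e = c + t *: (b - a).
Proof.
move=> abc; have /indepP ind := abc; split.
- move=> [ec [p [q [pab qac pq]]]].
  case: pab => [[x pE]|/esym/(indep_neq abc)//].
  case: qac => [[y qE]|/esym/(indep_neq (indepC abc))//].
  case=> [[l eE]|/esym//] nomeet.
  have {}eE : e = a + (x * (1 - l)) *: (b - a) + (l * y) *: (c - a).
    by rewrite eE qE pE; coordinatewise; ring.
  (* [l * y] is the coefficient of [c - a] in [e - a]; it equals 1 exactly when [ce] has the
     direction of [ab]. *)
  have [l1|l1] := eqVneq (l * y) 1.
    have {}eE : e = c + (x * (1 - l)) *: (b - a).
      by rewrite eE l1; coordinatewise; ring.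
    exists (x * (1 - l)) => //; apply/eqP => s0; apply: ec.
    by rewrite eE s0 scale0r addr0.
  have l1' : 1 - l * y != 0 by rewrite subr_eq0 eq_sym.
  (* The parameter is the one at which the line [ce] loses its component along [c - a], that is,
     meets [ab]. *)
  case: nomeet; exists (c + (1 - l * y)^-1 *: (e - c)); split; last by left; exists (1 - l * y)^-1.
  by left; exists (x * (1 - l) / (1 - l * y)); rewrite eE; coordinatewise; field.
- move=> [t t0 eE].
  have ec : e <> c.
    move=> ec; move/eqP: t0; apply; have [|//] := ind t 0.
    by apply: (addrI c); rewrite scale0r addr0 -eE ec addr0.
  split=> //.
  (* The third scalar gives a transversal through [e] that meets [ab] and [ac] in distinct points:
     both [l] and [1 - l] must be inverted. *)
  + have [l [l0 l1]] := F_gt2.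
    have l1' : 1 - l != 0 by rewrite subr_eq0 eq_sym.
    exists (a + (t / (1 - l)) *: (b - a)), (a + l^-1 *: (c - a)); split.
    * by left; exists (t / (1 - l)).
    * by left; exists l^-1.
    * move=> /addrI E; move/eqP: l0; apply; apply/eqP; rewrite -invr_eq0 -oppr_eq0; apply/eqP.
      by have [] := ind (t / (1 - l)) (- l^-1); rewrite // E; coordinatewise; ring.
    * left; exists l; rewrite eE; coordinatewise; field.
      by rewrite l0 l1'.
  + move=> [x [[[l xE]|/esym/(indep_neq abc)//]]].
    case=> [[m xE']|//].
    have [_ /eqP] : l - m * t = 0 /\ (-1 : F) = 0.
      apply: ind; apply/eqP; rewrite -(subrr x) {1}xE xE' eE -subr_eq0; apply/eqP.
      by coordinatewise; ring.
    by rewrite oppr_eq0 oner_eq0.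
Qed.

Definition pgram a b c e : Prop :=
  [/\ indep a b c, linepar a b c e & linepar a c b e].

(** The two parallels give [e = c + s *: (b - a)] and [e = b + t *: (c - a)]; independence forces
    [s = t = 1]. *)
Lemma pgramP a b c e : pgram a b c e <-> indep a b c /\ b - a = e - c.
Proof.
split=> [[abc]|[abc E]].
  move=> /(lineparP _ abc)[s s0 eE] /(lineparP _ (indepC abc))[t t0 eE'].
  split=> //; have [/eqP] : s - 1 = 0 /\ 1 - t = 0.
    have /indepP := abc; apply; apply/eqP; rewrite -(subrr e) {1}eE eE' -subr_eq0; apply/eqP.
    by coordinatewise; ring.
  by rewrite subr_eq0 => /eqP s1 _; rewrite eE s1; coordinatewise; ring.
have eE : e = c + (b - a) by rewrite E; coordinatewise; ring.
split=> //.
  by apply/lineparP => //; exists 1; rewrite ?oner_eq0 ?scale1r.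
apply/lineparP; first exact: indepC.
by exists 1; rewrite ?oner_eq0 // eE; coordinatewise; ring.
Qed.

(** Equal vectors on one line are compared with a translate off that line. *)
Lemma eqvecP a b c e : b - a = e - c <->
  [\/ a = b /\ c = e, pgram a b c e |
      exists p q, pgram a b p q /\ pgram p q c e].
Proof.
split=> [E|[[-> ->]|/pgramP[]//|[p [q [/pgramP[_ ->] /pgramP[_]]]]//]]; last first.
  by rewrite !subrr.
have [ab|/eqP ab] := eqVneq a b.
  constructor 1; split=> //; apply/esym/eqP; rewrite -subr_eq0 -E ab subrr; exact/eqP.
have [abc|abc] := EM (indep a b c); first by constructor 2; apply/pgramP.
have [[l cE]|/esym//] : collinear a c b by apply: contrapT.
have [p abp] := exists_indep ab.
constructor 3; exists p, (p + (b - a)); split; apply/pgramP; split=> //.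
- by coordinatewise; ring.
(* With [c] on [ab] at parameter [l], [c - p] equals [l *: (b - a) - (p - a)], so a relation for
   [p, q, c] becomes one for [a, b, p]. *)
- have /indepP ind := abp; apply/indepP => s t.
  move=> H; have [] := ind (s + t * l) (- t).
    by rewrite -H cE; coordinatewise; ring.
  by move=> + /eqP; rewrite oppr_eq0 => + /eqP t0; rewrite t0 mul0r addr0.
- by rewrite -E; coordinatewise; ring.
Qed.

Definition par a b c e : Prop := a <> b /\ exists l, e - c = l *: (b - a).

(** The vector [e - c] is laid off at [a], which leaves only equality of vectors and
    collinearity. *)
Lemma parP a b c e : par a b c e <->
  a <> b /\ exists q, q - a = e - c /\ collinear a q b.
Proof.
split=> -[ab] H; split=> //; move: H.
  move=> [l E]; exists (a + l *: (b - a)).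
  by split; [rewrite E; coordinatewise; ring|left; exists l].
by move=> [q [<- [[l ->]|/esym//]]]; exists l; coordinatewise; ring.
Qed.

Definition homothetic o a b x y : Prop :=
  indep o a b /\ exists l, x = o + l *: (a - o) /\ y = o + l *: (b - o).

(** This copies a scalar from the axis [oa] to the axis [ob]: expanding [y - x = n *: (b - a)] in
    the independent vectors [a - o] and [b - o] makes both scalars equal to [n]. *)
Lemma homotheticP o a b x y : homothetic o a b x y <->
  [/\ indep o a b, collinear o x a, collinear o y b & par a b x y].
Proof.
split=> [[oab [l [-> ->]]]|[oab]].
  split=> //; [by left; exists l|by left; exists l|split].
    by move=> ab; apply: oab; left; exists 1; rewrite ab scale1r; coordinatewise; ring.
  by exists l; coordinatewise; ring.
case=> [[l xE]|/esym/(indep_neq oab)//].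
case=> [[m yE]|/esym/(indep_neq (indepC oab))//].
move=> [_ [n E]]; split=> //; exists l.
have [/eqP + /eqP] : n - l = 0 /\ m - n = 0.
  have /indepP := oab; apply; transitivity ((y - x) - n *: (b - a)).
    by rewrite xE yE; coordinatewise; ring.
  by rewrite E subrr.
by rewrite !subr_eq0 => /eqP nl /eqP mn; rewrite yE mn nl.
Qed.

Definition product o a b x y z : Prop := indep o a b /\
  exists l m, [/\ x = o + l *: (a - o), y = o + m *: (a - o)
                & z = o + (l * m) *: (a - o)].

(** Multiplication by Thales: the parallel to [bx] through the copy [w] of [y] on the
    axis [ob] cuts the axis [oa] at the product. *)
Lemma productP o a b x y z : product o a b x y z <->
  collinear o x a /\ exists w, [/\ homothetic o a b y w, par b x w z & collinear o z a].
Proof.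
split=> [[oab [l [m [-> -> ->]]]]|].
  split; [by left; exists l|exists (o + m *: (b - o)); split].
  - by split=> //; exists m.
  - split; last by exists m; coordinatewise; ring.
    by move=> bE; apply: oab; left; exists l.
  - by left; exists (l * m).
move=> [xoa [w [[oab [m [yE wE]]] [_ [n E]] zoa]]].
case: xoa => [[l xE]|/esym/(indep_neq oab)//].
case: zoa => [[k zE]|/esym/(indep_neq oab)//].
split=> //; exists l, m; split=> //.
have [/eqP + /eqP] : k - n * l = 0 /\ n - m = 0.
  have /indepP := oab; apply; transitivity ((z - w) - n *: (x - b)).
    by rewrite xE wE zE; coordinatewise; ring.
  by rewrite E subrr.
by rewrite !subr_eq0 => /eqP + /eqP nm; rewrite nm zE mulrC => ->.
Qed.

Section Definability.
Variables (L : sig) (S : structure L pt).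
Hypothesis dfn_collinear : forall (C : ctx pt) (x y z : env C -> pt),
  var C x -> var C y -> var C z ->
  dfn S (fun e : env C => collinear (x e) (y e) (z e)).

Lemma dfn_indep (C : ctx pt) (X Y Z : env C -> pt) : var C X -> var C Y -> var C Z ->
  dfn S (fun e => indep (X e) (Y e) (Z e)).
Proof. by move=> *; apply/dfn_not/dfn_collinear. Qed.

Lemma dfn_linepar (C : ctx pt) (X Y Z W : env C -> pt) :
  var C X -> var C Y -> var C Z -> var C W ->
  dfn S (fun e => linepar (X e) (Y e) (Z e) (W e)).
Proof.
move=> XV YV ZV WV; apply: dfn_and3.
- by apply: dfn_not; apply: dfn_eq; solve_var.
- apply: dfn_ex; apply: dfn_ex; apply: dfn_and4.
  + by apply: dfn_collinear; solve_var.
  + by apply: dfn_collinear; solve_var.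
  + by apply: dfn_not; apply: dfn_eq; solve_var.
  + by apply: dfn_collinear; solve_var.
- by apply: dfn_not; apply: dfn_ex; apply: dfn_and; apply: dfn_collinear; solve_var.
Qed.

Lemma dfn_pgram (C : ctx pt) (X Y Z W : env C -> pt) :
  var C X -> var C Y -> var C Z -> var C W ->
  dfn S (fun e => pgram (X e) (Y e) (Z e) (W e)).
Proof.
move=> XV YV ZV WV.
by apply: dfn_and3; [apply: dfn_indep|apply: dfn_linepar|apply: dfn_linepar].
Qed.

Lemma dfn_eqvec (C : ctx pt) (X Y Z W : env C -> pt) : var C X -> var C Y -> var C Z -> var C W ->
  dfn S (fun e => Y e - X e = W e - Z e).
Proof.
move=> XV YV ZV WV; apply: dfn_iff (fun e => eqvecP _ _ _ _) _.
apply: dfn_or3.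
- by apply: dfn_and; apply: dfn_eq.
- exact: dfn_pgram.
- by apply: dfn_ex; apply: dfn_ex; apply: dfn_and; apply: dfn_pgram => //; solve_var.
Qed.

Lemma dfn_par (C : ctx pt) (X Y Z W : env C -> pt) : var C X -> var C Y -> var C Z -> var C W ->
  dfn S (fun e => par (X e) (Y e) (Z e) (W e)).
Proof.
move=> XV YV ZV WV; apply: dfn_iff (fun e => parP _ _ _ _) _.
apply: dfn_and; first by apply: dfn_not; apply: dfn_eq.
by apply: dfn_ex; apply: dfn_and; [apply: dfn_eqvec|apply: dfn_collinear]; solve_var.
Qed.

Lemma dfn_homothetic (C : ctx pt) (X Y Z W V : env C -> pt) :
  var C X -> var C Y -> var C Z -> var C W -> var C V ->
  dfn S (fun e => homothetic (X e) (Y e) (Z e) (W e) (V e)).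
Proof.
move=> XV YV ZV WV VV; apply: dfn_iff (fun e => homotheticP _ _ _ _ _) _.
by apply: dfn_and4; [apply: dfn_indep|apply: dfn_collinear|apply: dfn_collinear|apply: dfn_par].
Qed.

Lemma dfn_product (C : ctx pt) (X Y Z W V U : env C -> pt) :
  var C X -> var C Y -> var C Z -> var C W -> var C V -> var C U ->
  dfn S (fun e => product (X e) (Y e) (Z e) (W e) (V e) (U e)).
Proof.
move=> XV YV ZV WV VV UV; apply: dfn_iff (fun e => productP _ _ _ _ _ _) _.
apply: dfn_and; first exact: dfn_collinear.
apply: dfn_ex; apply: dfn_and3.
- by apply: dfn_homothetic; solve_var.
- by apply: dfn_par; solve_var.
- by apply: dfn_collinear; solve_var.
Qed.

End Definability.

End AffineGeometry.

(** * Frames and coordinates *)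

Section Frames.
Variables (F : fieldType) (d : nat).
Local Notation pt := 'rV[F]_d.+2.
Implicit Types (f : 'I_d.+3 -> pt) (c : F).

Definition origin f := f ord0.
Definition unit_pt f (j : 'I_d.+2) := f (lift ord0 j).
Definition on_axis f c := origin f + c *: (unit_pt f ord0 - origin f).
Definition frame_mx f : 'M[F]_d.+2 := \matrix_j (unit_pt f j - origin f).
Definition frame f : Prop := frame_mx f \in unitmx.

(** Weaker than [frame], but enough for the field operations on the first axis and for
    moving scalars between axes; [frame] is then recovered as in [frameP]. *)
Definition preframe f : Prop :=
  forall j, j != ord0 -> indep (origin f) (unit_pt f ord0) (unit_pt f j).

(** Each coordinate is represented by a point of the first axis, so that only points are ever
    quantified in the geometry. *)
Definition coords f (x : pt) (z : 'I_d.+2 -> pt) : Prop :=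
  exists u : pt, (forall j, z j = on_axis f (u 0 j)) /\ x = origin f + u *m frame_mx f.

Lemma mul_frame_mx f (u : pt) :
  u *m frame_mx f = \sum_j u 0 j *: (unit_pt f j - origin f).
Proof. by rewrite mulmx_sum_row; apply: eq_bigr => j _; rewrite rowK. Qed.

Lemma preframe_neq f : preframe f -> origin f <> unit_pt f ord0.
Proof. by move=> /(_ ord_max isT)/indep_neq. Qed.

Lemma on_axis_inj f : preframe f -> injective (on_axis f).
Proof.
move=> /preframe_neq/eqP neq a b /addrI/eqP.
rewrite -subr_eq0 -scalerBl scaler_eq0 !subr_eq0 [in X in _ || X]eq_sym.
by rewrite (negPf neq) orbF => /eqP.
Qed.

Lemma on_axisP f x : preframe f ->
  collinear (origin f) x (unit_pt f ord0) <-> exists c, x = on_axis f c.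
Proof.
move=> pf; split=> [[//|/esym/(preframe_neq pf)//]|[c ->]].
by left; exists c.
Qed.

(** [w j] is the copy of [z j] on axis [j], and [x] is the vector sum of these copies. For
    [j = ord0] the homothety would be degenerate, so membership in the axis is required instead. *)
Lemma coordsP f x z : preframe f -> coords f x z <-> exists w : 'I_d.+2 -> pt,
  (forall j, if j == ord0 then w j = z j /\ collinear (origin f) (z j) (unit_pt f ord0)
   else homothetic (origin f) (unit_pt f ord0) (unit_pt f j) (z j) (w j)) /\
  x - origin f = \sum_j (w j - origin f).
Proof.
move=> pf; split=> [[u [zE ->]]|[w [wz xE]]].
  exists (fun j => origin f + u 0 j *: (unit_pt f j - origin f)); split=> [j|].
    case: eqP => [->|/eqP j0]; first by rewrite zE; split=> //; left; exists (u 0 ord0).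
    by split; [apply: pf|exists (u 0 j)].
  rewrite addrC addKr mul_frame_mx; apply: eq_bigr => j _.
  by rewrite [RHS]addrC addKr.
have /fin_all_exists[u uE] j : exists c, z j = on_axis f c /\
    w j - origin f = c *: (unit_pt f j - origin f).
  move: (wz j); case: eqP => [-> [-> /(on_axisP _ pf)[c ->]]|_ [_ [c [-> ->]]]]; exists c;
  by split=> //; rewrite addrC addKr.
exists (\row_j u j); split=> [j|]; first by rewrite mxE (uE j).1.
apply: (addIr (- origin f)); rewrite xE addrAC subrr add0r mul_frame_mx.
by apply: eq_bigr => j _; rewrite mxE (uE j).2.
Qed.

(** If every point has coordinates, the rows of the square matrix [frame_mx f] span the space, so it
    is invertible. *)
Lemma frameP f : frame f <-> preframe f /\ forall x, exists z, coords f x z.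
Proof.
split=> [ff|[pf span]]; last first.
  rewrite /frame -row_full_unit -sub1mx; apply/rV_subP => v _.
  have [z [u [_ E]]] := span (origin f + v).
  by move/addrI: E => ->; apply: submxMl.
split=> [j j0|x]; last first.
  pose u := (x - origin f) *m invmx (frame_mx f).
  exists (fun j => on_axis f (u 0 j)), u; split=> //.
  by rewrite mulmxKV // addrC subrK.
apply/indepP => s t E.
have : (s *: (delta_mx 0 ord0 : pt) + t *: (delta_mx 0 j : pt)) *m frame_mx f = 0.
  by rewrite mulmxDl -!scalemxAl -!rowE !rowK.
move/(congr1 (mulmx^~ (invmx (frame_mx f)))); rewrite mulmxK // mul0mx => H.
have := congr1 (fun u : pt => u 0 ord0) H; have := congr1 (fun u : pt => u 0 j) H.
rewrite !mxE !eqxx [ord0 == j]eq_sym (negPf j0) /= !mulr1 !mulr0 add0r addr0.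
by move=> -> ->.
Qed.

Hypothesis F_gt2 : exists l : F, l != 0 /\ l != 1.
Variables (L : sig) (S : structure L pt).
Hypothesis dfn_collinear : forall (C : ctx pt) (x y z : env C -> pt),
  var C x -> var C y -> var C z ->
  dfn S (fun e : env C => collinear (x e) (y e) (z e)).

(** The endpoint [y] of the partial sum is quantified, so each step is one equality of vectors. *)
Lemma dfn_vector_sum n (C : ctx pt) (x o : env C -> pt) (w : env C -> 'I_n -> pt) :
  var C x -> var C o -> (forall j, var C (fun e => w e j)) ->
  dfn S (fun e => x e - o e = \sum_j (w e j - o e)).
Proof.
elim: n C x o w => [|n IH] C x o w xV oV wV.
  apply: (@dfn_iff _ _ _ _ _ (fun e => x e = o e)) => [e|]; last exact: dfn_eq.
  by rewrite big_ord0; split=> [/eqP|->]; rewrite ?subr_eq0 ?subrr // => /eqP.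
apply: (@dfn_iff _ _ _ _ _ (fun e => exists y,
  y - o e = \sum_j (w e (widen_ord (leqnSn n) j) - o e) /\
  x e - y = w e ord_max - o e)) => [e|].
  rewrite big_ord_recr /=; split=> [E|[y [<- <-]]]; last by rewrite addrC addrA subrK.
  exists (x e - (w e ord_max - o e)); split; last by rewrite opprB addrC subrK.
  by rewrite addrAC E addrK.
apply: dfn_ex; apply: dfn_and.
  by apply: IH => [||j]; solve_var.
by apply: dfn_eqvec => //; solve_var.
Qed.

Lemma dfn_preframe (C : ctx pt) (f : env C -> 'I_d.+3 -> pt) :
  (forall i, var C (fun e => f e i)) -> dfn S (fun e => preframe (f e)).
Proof.
move=> fV; apply: dfn_forall_ord => j; case: (eqVneq j ord0) => [->|j0].
  by apply: (@dfn_iff _ _ _ _ _ (fun _ => True)) => //; apply: dfn_true.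
apply: (@dfn_iff _ _ _ _ _ (fun e => indep (origin (f e)) (unit_pt (f e) ord0) (unit_pt (f e) j))).
  by move=> e; split=> [/(_ isT)|].
by apply: dfn_indep => //; apply: fV.
Qed.
(** [preframe] is kept inside the predicate because [coordsP] is stated for preframes. *)
Lemma dfn_coords (C : ctx pt) (f : env C -> 'I_d.+3 -> pt) (x : env C -> pt)
    (z : env C -> 'I_d.+2 -> pt) :
  (forall i, var C (fun e => f e i)) -> var C x -> (forall i, var C (fun e => z e i)) ->
  dfn S (fun e => preframe (f e) /\ coords (f e) (x e) (z e)).
Proof.
move=> fV xV zV.
apply: (@dfn_iff _ _ _ _ _ (fun e => preframe (f e) /\ exists w : 'I_d.+2 -> pt,
  (forall j, if j == ord0 then w j = z e j /\
       collinear (origin (f e)) (z e j) (unit_pt (f e) ord0)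
     else homothetic (origin (f e)) (unit_pt (f e) ord0) (unit_pt (f e) j) (z e j) (w j)) /\
  x e - origin (f e) = \sum_j (w j - origin (f e)))) => [e|].
  by split=> -[pf] /(coordsP _ _ pf).
apply: dfn_and; first exact: dfn_preframe.
have oV : var C (fun e => origin (f e)) by apply: fV.
have uV j : var C (fun e => unit_pt (f e) j) by apply: fV.
apply: dfn_exn; apply: dfn_and; last by apply: dfn_vector_sum => [||j]; solve_var.
apply: dfn_forall_ord => j; case: (j == ord0).
  by apply: dfn_and; [apply: dfn_eq|apply: dfn_collinear]; solve_var.
by apply: dfn_homothetic => //; solve_var.
Qed.

Lemma dfn_frame (C : ctx pt) (f : env C -> 'I_d.+3 -> pt) :
  (forall i, var C (fun e => f e i)) -> dfn S (fun e => frame (f e)).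
Proof.
move=> fV; apply: (@dfn_iff _ _ _ _ _ (fun e => preframe (f e) /\
  forall x, exists z, preframe (f e) /\ coords (f e) x z)) => [e|].
  rewrite frameP; split=> -[pf H]; split=> // x; have [z] := H x; first by exists z.
  by case; exists z.
apply: dfn_and; first exact: dfn_preframe.
by apply: dfn_all; apply: dfn_exn; apply: dfn_coords => [i||i]; solve_var.
Qed.

End Frames.

(** * Translations between the geometry and the field *)

Section Automorphisms.
Variables (L : sig) (M : Type) (S : structure L M) (f : M -> M).
Hypothesis f_aut : automorphism S f.

Lemma eval_aut e t : eval S (f \o e) t = f (eval S e t).
Proof.
elim: t => [//|g a IH] /=; rewrite (f_aut.2.1 g); congr fint.
by apply: funext => k; rewrite IH.
Qed.

(** Injectivity handles equations, surjectivity handles quantifiers. *)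
Lemma sat_aut p e : sat S e p <-> sat S (f \o e) p.
Proof.
have [[f' fK f'K] [_ frel]] := f_aut.
have updf (e' : nat -> M) i x : upd (f \o e') i (f x) = f \o upd e' i x.
  by apply: funext => k; rewrite /upd /=; case: eqP.
elim: p e => [t1 t2|r a|p IH|p IHp q IHq|p IHp q IHq|p IHp q IHq|i p IH|i p IH] e /=.
- by rewrite !eval_aut; split=> [->//|/(can_inj fK)].
- rewrite frel; have -> // : f \o (fun k => eval S e (a k)) = (fun k => eval S (f \o e) (a k)).
  by apply: funext => k; rewrite eval_aut.
- by rewrite IH.
- by rewrite IHp IHq.
- by rewrite IHp IHq.
- by rewrite IHp IHq.
- split=> -[x]; first by rewrite IH -updf; exists (f x).
  by rewrite -[x]f'K updf -IH; exists (f' x).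
- split=> H x; last by rewrite IH -updf.
  by rewrite -[x]f'K updf -IH.
Qed.

Lemma definable_closed (m0 : M) n (R : ('I_n -> M) -> Prop) :
  definable S n R -> closed_under R f.
Proof.
move=> [p pE] a; pose e k := if insub k is Some i then a i else m0.
have eE : (fun i : 'I_n => e i) = a by apply: funext => i; rewrite /e valK.
by rewrite -eE pE sat_aut -pE.
Qed.

End Automorphisms.

Section Translation.
Variables (F : fieldType) (d : nat).
Local Notation pt := 'rV[F]_d.+2.
Hypothesis F_gt2 : exists l : F, l != 0 /\ l != 1.

Variables (LB : sig) (B : structure LB F) (LG : sig) (G : structure LG pt).
Hypothesis G_relational : relational LG.

(** Quotient and remainder by the dimension invert [flat]. *)
Lemma flat_row n (k : 'I_(n * d.+2)) : (k %/ d.+2 < n)%N.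
Proof. by rewrite ltn_divLR. Qed.

(** * Point formulas as field formulas *)

Section PointsToField.
Hypothesis G_over_B : forall r : rsym LG, definable_over B (rint G r).

(** With assignments of points as environments and their coordinates as field variables,
    satisfaction in [G] is itself a predicate over a field context. *)
Definition point_coord (x : (nat -> pt) -> F) : Prop :=
  exists i j, forall e, x e = e i 0 j.

Lemma point_coord_inhabited : exists x, point_coord x.
Proof. by exists (fun e => e 0%N 0 0), 0%N, 0. Qed.

Definition points_ctx : ctx F := Ctx point_coord_inhabited.

Lemma relational_term (t : term LG) : exists i, forall e, eval G e t = e i.
Proof. by case: t => [i|g]; [exists i|case: (G_relational g)]. Qed.

Lemma dfn_definable_over (C : ctx F) n (R : ('I_n -> pt) -> Prop) (x : env C -> 'I_n -> pt) :
  definable_over B R -> (forall i j, var C (fun e => x e i 0 j)) -> dfn B (fun e => R (x e)).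
Proof.
move=> dR xV.
apply: (@dfn_iff _ _ _ _ _ (fun e =>
  hat R (fun k : 'I_(n * d.+2) => x e (Ordinal (flat_row k)) 0 (inord (k %% d.+2))))) => [e|].
  rewrite /hat; set y := (X in _ <-> R X); have -> // : y = x e.
  apply: funext => i; apply/rowP => j; rewrite mxE; congr (x e _ _ _); apply: val_inj => /=.
    by rewrite divnMDl // divn_small ?addn0.
  by rewrite modnMDl modn_small // inordK.
by apply: dfn_definable.
Qed.

Lemma dfn_sat_points (p : formula LG) : @dfn _ _ B points_ctx (fun e => sat G e p).
Proof.
have row_coords (x : pt) : \row_j x 0 j = x by apply/rowP => j; rewrite mxE.
(* Binding the point of index [i] binds its coordinates: a coordinate of that point becomes a bound
   scalar, every other one stays an outer variable. *)
have dfn_upd i (P : (nat -> pt) -> Prop) : @dfn _ _ B points_ctx P ->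
    @dfn _ _ B (ctxn points_ctx d.+2) (fun em => P (upd em.1 i (\row_j em.2 j))).
  move=> dP; apply: (dfn_sub (C := points_ctx) (C' := ctxn points_ctx d.+2)
    (h := fun em => upd em.1 i (\row_j em.2 j)) _ dP) => x [k [j xE]].
  have [ki|/negPf ki] := eqVneq k i.
    by right; exists j => e m; rewrite /= xE /upd ki eqxx mxE.
  by left; exists (fun e => e k 0 j) => [e m|]; [rewrite /= xE /upd ki|exists k, j].
elim: p => [t1 t2|r a|p IH|p IHp q IHq|p IHp q IHq|p IHp q IHq|i p IH|i p IH] /=.
- have [i iE] := relational_term t1; have [j jE] := relational_term t2.
  apply: (@dfn_iff _ _ _ points_ctx _ (fun e => forall k : 'I_d.+2, e i 0 k = e j 0 k)) => [e|].
    by rewrite iE jE; split=> [-> //|/rowP].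
  by apply: dfn_forall_ord => k; apply: dfn_eq; [exists i, k|exists j, k].
- have [i iE] := fin_all_exists (fun k => relational_term (a k)).
  apply: (@dfn_iff _ _ _ points_ctx _ (fun e : nat -> pt => rint G r (fun k => e (i k)))) => [e|].
    by have -> // : (fun k => eval G e (a k)) = (fun k => e (i k)) by apply: funext.
  by apply: dfn_definable_over => [//|k j]; exists (i k), j.
- exact: dfn_not.
- exact: dfn_and.
- exact: dfn_or.
- exact: dfn_imp.
- apply: (@dfn_iff _ _ _ points_ctx _ (fun e => exists x : 'I_d.+2 -> F,
      sat G (upd e i (\row_j x j)) p)) => [e|].
    split=> [[x]|[x]]; last by exists (\row_j x j).
    by exists (x 0); rewrite row_coords.
  by apply: dfn_exn; apply: (dfn_upd _ _ IH).
- apply: (@dfn_iff _ _ _ points_ctx _ (fun e => forall x : 'I_d.+2 -> F,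
      sat G (upd e i (\row_j x j)) p)) => [e|].
    split=> H x; first exact: H.
    by rewrite -[x]row_coords.
  by apply: dfn_alln; apply: (dfn_upd _ _ IH).
Qed.

Lemma definable_over_of_definable n (R : ('I_n -> pt) -> Prop) :
  definable G n R -> definable_over B R.
Proof.
move=> [p pE]; apply: dfn_baseE.
(* Scalars are cut into rows in the order prescribed by [flat]. *)
pose h (e : nat -> F) i : pt := \row_j e (i * d.+2 + j)%N.
apply: (@dfn_iff _ _ _ (ctx_base F) _ ((fun e => sat G e p) \o h)) => [e|]; first by rewrite /= -pE.
apply: dfn_sub (dfn_sat_points p) => x [i [j xE]].
by exists (i * d.+2 + j)%N => e; rewrite /= xE mxE.
Qed.

End PointsToField.

(** * Field formulas evaluated on the first axis of a frame *)

Section FieldToPoints.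
Hypothesis dfn_collinear : forall (C : ctx pt) (x y z : env C -> pt),
  var C x -> var C y -> var C z -> dfn G (fun e => collinear (x e) (y e) (z e)).

(** A defining predicate [P] is only required to be right on preframes and on points of
    the first axis; elsewhere it is arbitrary. *)
Definition fint_definable : Prop := forall (g : Defs.fsym LB) (C : ctx pt)
    (f : env C -> 'I_d.+3 -> pt) (a : env C -> 'I_(fari g) -> pt) (y : env C -> pt),
  (forall i, var C (fun e => f e i)) -> (forall i, var C (fun e => a e i)) -> var C y ->
  exists2 P, dfn G P & forall e (c : 'I_(fari g) -> F), preframe (f e) ->
    (forall k, a e k = on_axis (f e) (c k)) -> P e <-> y e = on_axis (f e) (fint B g c).

Definition rint_definable : Prop := forall (r : rsym LB) (C : ctx pt)
    (f : env C -> 'I_d.+3 -> pt) (a : env C -> 'I_(rari r) -> pt),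
  (forall i, var C (fun e => f e i)) -> (forall i, var C (fun e => a e i)) ->
  exists2 P, dfn G P & forall e (c : 'I_(rari r) -> F), preframe (f e) ->
    (forall k, a e k = on_axis (f e) (c k)) -> P e <-> rint B r c.

Hypotheses (B_fint : fint_definable) (B_rint : rint_definable).

(** Field operations are only relations on the axis, so the values of the subterms are quantified as
    points [m]. *)
Lemma eval_on_axis (t : term LB) (C : ctx pt)
    (f : env C -> 'I_d.+3 -> pt) (z : env C -> nat -> pt) (y : env C -> pt) :
  (forall i, var C (fun e => f e i)) -> (forall i, var C (fun e => z e i)) -> var C y ->
  exists2 P, dfn G P & forall e (c : nat -> F), preframe (f e) ->
    (forall k, z e k = on_axis (f e) (c k)) -> P e <-> y e = on_axis (f e) (eval B c t).
Proof.
elim: t C f z y => [i|g a IH] C f z y fV zV yV.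
  by exists (fun e => y e = z e i) => [|e c _ ->]; first exact: dfn_eq.
have /fin_all_exists2[P dP PE] k := IH k (ctxn C (fari g)) (fun em => f em.1)
  (fun em => z em.1) (fun em => em.2 k) ltac:(move=> i; solve_var)
  ltac:(move=> i; solve_var) ltac:(solve_var).
have [Q dQ QE] := B_fint (C := ctxn C (fari g)) (f := fun em => f em.1) (a := fun em => em.2)
  (y := fun em => y em.1) ltac:(move=> i; solve_var)
  ltac:(move=> i; solve_var) ltac:(solve_var).
exists (fun e => exists m : 'I_(fari g) -> pt, (forall k, P k (e, m)) /\ Q (e, m)).
  apply: dfn_exn; apply: dfn_and.
    apply: dfn_forall_ord => k; apply: dfn_iff (dP k) => -[e m] //.
  by apply: dfn_iff dQ => -[e m].
move=> e c pf zE; split=> [[m [Pm]]|yE].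
  have mE k : m k = on_axis (f e) (eval B c (a k)) by apply/(PE k (e, m) c pf zE).
  by move/(QE (e, m) _ pf mE).
pose m k := on_axis (f e) (eval B c (a k)).
have mE k : m k = on_axis (f e) (eval B c (a k)) by [].
by exists m; split=> [k|]; [apply/(PE k (e, m) c pf zE)|apply/(QE (e, m) _ pf mE)].
Qed.

(** Scalar quantifiers are relativized to the first axis, and equations are tested through a common
    value, [on_axis] being injective. The context is general because the induction enters extended
    ones. *)
Lemma sat_on_axis (q : formula LB) (C : ctx pt)
    (f : env C -> 'I_d.+3 -> pt) (z : env C -> nat -> pt) :
  (forall i, var C (fun e => f e i)) -> (forall i, var C (fun e => z e i)) ->
  exists2 P, dfn G P & forall e (c : nat -> F), preframe (f e) ->
    (forall k, z e k = on_axis (f e) (c k)) -> P e <-> sat B c q.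
Proof.
have quant (C0 : ctx pt) (z0 : env C0 -> nat -> pt) i :
    (forall j, var C0 (fun e => z0 e j)) ->
    forall j, var (ctx1 C0) (fun em => upd (z0 em.1) i em.2 j).
  by move=> z0V j; rewrite /upd; case: (j == i); solve_var.
have updE (f0 : 'I_d.+3 -> pt) (z0 : nat -> pt) c i x : (forall k, z0 k = on_axis f0 (c k)) ->
    forall k, upd z0 i (on_axis f0 x) k = on_axis f0 (upd c i x k).
  by move=> z0E k; rewrite /upd; case: (k == i).
elim: q C f z => [t1 t2|r a|p IH|p IHp q IHq|p IHp q IHq|p IHp q IHq|i p IH|i p IH] C f z fV zV.
- have [P1 dP1 P1E] := eval_on_axis t1 (C := ctx1 C) (f := fun em => f em.1)
    (z := fun em => z em.1) (y := fun em => em.2) ltac:(move=> i; solve_var)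
    ltac:(move=> i; solve_var) ltac:(solve_var).
  have [P2 dP2 P2E] := eval_on_axis t2 (C := ctx1 C) (f := fun em => f em.1)
    (z := fun em => z em.1) (y := fun em => em.2) ltac:(move=> i; solve_var)
    ltac:(move=> i; solve_var) ltac:(solve_var).
  exists (fun e => exists y, P1 (e, y) /\ P2 (e, y)).
    by apply: dfn_ex; apply: dfn_and; [apply: dfn_iff dP1|apply: dfn_iff dP2] => -[].
  move=> e c pf zE /=; split=> [[y [/(P1E (e, y) c pf zE)/= -> ]]|E].
    by move/(P2E (e, _) c pf zE); apply: on_axis_inj.
  exists (on_axis (f e) (eval B c t1)).
  by split; [apply/(P1E (e, _) c pf zE)|apply/(P2E (e, _) c pf zE); rewrite E].
- have /fin_all_exists2[P dP PE] k := eval_on_axis (a k) (C := ctxn C (rari r))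
    (f := fun em => f em.1) (z := fun em => z em.1) (y := fun em => em.2 k)
    ltac:(move=> i; solve_var) ltac:(move=> i; solve_var) ltac:(solve_var).
  have [Q dQ QE] := B_rint (C := ctxn C (rari r)) (f := fun em => f em.1)
    (a := fun em => em.2) ltac:(move=> i; solve_var) ltac:(move=> i; solve_var).
  exists (fun e => exists m : 'I_(rari r) -> pt, (forall k, P k (e, m)) /\ Q (e, m)).
    apply: dfn_exn; apply: dfn_and.
      apply: dfn_forall_ord => k; apply: dfn_iff (dP k) => -[e m] //.
    by apply: dfn_iff dQ => -[e m].
  move=> e c pf zE; split=> [[m [Pm]]|rE].
    have mE k : m k = on_axis (f e) (eval B c (a k)) by apply/(PE k (e, m) c pf zE).
    by move/(QE (e, m) _ pf mE).
  pose m k := on_axis (f e) (eval B c (a k)).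
  have mE k : m k = on_axis (f e) (eval B c (a k)) by [].
  by exists m; split=> [k|]; [apply/(PE k (e, m) c pf zE)|apply/(QE (e, m) _ pf mE)].
- have [P dP PE] := IH C f z fV zV.
  by exists (fun e => ~ P e) => [|e c pf zE]; [exact: dfn_not|rewrite /= (PE e c)].
- have [P dP PE] := IHp C f z fV zV; have [Q dQ QE] := IHq C f z fV zV.
  by exists (fun e => P e /\ Q e) => [|e c pf zE]; [exact: dfn_and|rewrite /= (PE e c) ?(QE e c)].
- have [P dP PE] := IHp C f z fV zV; have [Q dQ QE] := IHq C f z fV zV.
  by exists (fun e => P e \/ Q e) => [|e c pf zE]; [exact: dfn_or|rewrite /= (PE e c) ?(QE e c)].
- have [P dP PE] := IHp C f z fV zV; have [Q dQ QE] := IHq C f z fV zV.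
  by exists (fun e => P e -> Q e) => [|e c pf zE]; [exact: dfn_imp|rewrite /= (PE e c) ?(QE e c)].
- have [P dP PE] := IH (ctx1 C) (fun em => f em.1) (fun em => upd (z em.1) i em.2)
    ltac:(move=> j; solve_var) (quant C z i zV).
  exists (fun e => exists y, collinear (origin (f e)) y (unit_pt (f e) ord0) /\ P (e, y)).
    apply: dfn_ex; apply: dfn_and; last by apply: dfn_iff dP => -[].
    by apply: dfn_collinear; solve_var.
  move=> e c pf zE /=; split=> [[y [/(on_axisP _ pf)[x ->]]]|[x]].
    by move/(PE (e, on_axis (f e) x) (upd c i x) pf (updE _ _ _ i x zE)); exists x.
  exists (on_axis (f e) x); split; first by apply/on_axisP => //; exists x.
  by apply/(PE (e, on_axis (f e) x) (upd c i x) pf (updE _ _ _ i x zE)).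
- have [P dP PE] := IH (ctx1 C) (fun em => f em.1) (fun em => upd (z em.1) i em.2)
    ltac:(move=> j; solve_var) (quant C z i zV).
  exists (fun e => forall y, collinear (origin (f e)) y (unit_pt (f e) ord0) -> P (e, y)).
    apply: dfn_all; apply: dfn_imp; last by apply: dfn_iff dP => -[].
    by apply: dfn_collinear; solve_var.
  move=> e c pf zE /=; split=> [H x|H y /(on_axisP _ pf)[x ->]]; last first.
    exact/(PE (e, on_axis (f e) x) (upd c i x) pf (updE _ _ _ i x zE)).
  apply/(PE (e, on_axis (f e) x) (upd c i x) pf (updE _ _ _ i x zE)).
  by apply/H/on_axisP => //; exists x.
Qed.

Definition frame_coord (f : 'I_d.+3 -> pt) (x : pt) : pt :=
  (x - origin f) *m invmx (frame_mx f).

Lemma coordsE f x z : frame f ->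
  coords f x z <-> forall j, z j = on_axis f (frame_coord f x 0 j).
Proof.
rewrite /frame_coord => ff; split=> [[u [zE ->]] j|zE].
  by rewrite [X in X *m _]addrC addKr mulmxK.
by exists ((x - origin f) *m invmx (frame_mx f)); rewrite mulmxKV // [RHS]addrC subrK.
Qed.

(** The coordinates of all arguments are quantified as axis points [w], and the field formula for
    [R] is evaluated on them by [sat_on_axis]. *)
Lemma dfn_transport n (R : ('I_n -> pt) -> Prop) (C : ctx pt)
    (f : env C -> 'I_d.+3 -> pt) (x : env C -> 'I_n -> pt) :
  definable_over B R ->
  (forall i, var C (fun e => f e i)) -> (forall i, var C (fun e => x e i)) ->
  dfn G (fun e => frame (f e) /\ R (fun i => frame_coord (f e) (x e i))).
Proof.
move=> [q qE] fV xV.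
pose D := ctxn C (n * d.+2).
(* Indices out of range are read at the origin, which represents 0; the default of [c] below must
   agree with this. *)
pose z (em : env D) k := if insub k is Some i then em.2 i else origin (f em.1).
have zV k : var D (fun em => z em k) by rewrite /z; case: insub => [i|]; solve_var.
have [P dP PE] := sat_on_axis q (C := D) (f := fun em => f em.1) (z := z)
  ltac:(move=> i; solve_var) zV.
apply: (@dfn_iff _ _ _ _ _ (fun e => frame (f e) /\ exists w : 'I_(n * d.+2) -> pt,
   (forall i, preframe (f e) /\ coords (f e) (x e i) (fun j => w (flat i j))) /\ P (e, w)))
   => [e|]; last first.
  apply: dfn_and; first exact: dfn_frame.
  apply: dfn_exn; apply: dfn_and; last by apply: dfn_iff dP => -[].
  by apply: dfn_forall_ord => i; apply: dfn_coords => // [j||j]; solve_var.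
have xR (ff : frame (f e)) (w : 'I_(n * d.+2) -> pt) :
    (forall i j, w (flat i j) = on_axis (f e) (frame_coord (f e) (x e i) 0 j)) ->
    P (e, w) <-> R (fun i => frame_coord (f e) (x e i)).
  move=> wE; have [pf _] := (frameP _).1 ff.
  pose c k := if insub (k %/ d.+2)%N is Some i then
    frame_coord (f e) (x e i) 0 (inord (k %% d.+2)) else 0.
  have cE i j : c (flat i j) = frame_coord (f e) (x e i) 0 j.
    by rewrite /c /= divnMDl // divn_small // addn0 valK modnMDl modn_small // inord_val.
  rewrite (PE (e, w) c pf); last first.
    move=> k; rewrite /z /=; case: insubP => [k' _ kE|kn].
      have kE' : k' = flat (Ordinal (flat_row k')) (inord (k' %% d.+2)).
        by apply: val_inj; rewrite /= inordK ?ltn_pmod // -divn_eq.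
      by rewrite -kE kE' cE wE.
    by rewrite /c insubN ?ltn_divLR // /on_axis scale0r addr0.
  rewrite -qE /hat; set y := (X in R X <-> _).
  have -> // : y = (fun i => frame_coord (f e) (x e i)).
  by apply: funext => i; apply/rowP => j; rewrite mxE cE.
split=> -[ff H]; split=> //.
  exists (fun k : 'I_(n * d.+2) => on_axis (f e)
    (frame_coord (f e) (x e (Ordinal (flat_row k))) 0 (inord (k %% d.+2)))).
  have wE i j : on_axis (f e) (frame_coord (f e) (x e (Ordinal (flat_row (flat i j)))) 0
      (inord (flat i j %% d.+2))) = on_axis (f e) (frame_coord (f e) (x e i) 0 j).
    congr (on_axis _ (frame_coord _ (x e _) _ _)); apply: val_inj => /=.
      by rewrite divnMDl // divn_small ?addn0.
    by rewrite modnMDl modn_small // inordK.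
  split; last exact/xR.
  by move=> i; split; [have [] := (frameP _).1 ff|apply/coordsE].
case: H => w [wE Pw]; apply/(xR ff w) => // i j.
by have /(coordsE _ _ ff) := (wE i).2.
Qed.

Hypothesis G_over_B : forall r : rsym LG, definable_over B (rint G r).
Hypothesis G_finite : finitely_many_rels LG.

(** [frame_coord f] inverts [g], so the invariance hypothesis taken at [g \o a] is the automorphism
    condition for [g]. *)
Lemma frame_affine_automorphism (f : 'I_d.+3 -> pt) : frame f ->
  (forall (r : rsym LG) a, rint G r a <-> rint G r (fun i => frame_coord f (a i))) ->
  let g x := x *m frame_mx f + origin f in
  [/\ automorphism G g, affine g & cancel (frame_coord f) g].
Proof.
move=> ff fG g; have gK : cancel g (frame_coord f).
  by move=> x; rewrite /frame_coord /g addrK mulmxK.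
have gK' : cancel (frame_coord f) g.
  by move=> x; rewrite /frame_coord /g mulmxKV // subrK.
split=> //; last by exists (frame_mx f), (origin f).
split; first by exists (frame_coord f).
split=> [h|r a]; first by case: (G_relational h).
rewrite [X in _ <-> X]fG; have -> // : (fun i => frame_coord f ((g \o a) i)) = a.
by apply: funext => i; rewrite /= gK.
Qed.

Lemma definable_of_affine_closed n (R : ('I_n -> pt) -> Prop) :
  definable_over B R ->
  (forall g, automorphism G g -> affine g -> closed_under R g) ->
  definable G n R.
Proof.
move=> R_over_B Rclosed; have [k [rel rel_onto]] := G_finite.
apply: dfn_baseE.
(* Since [rel] lists finitely many relations, the condition on [f] is a finite conjunction, hence a
   single formula. *)
apply: (@dfn_iff _ _ _ (ctx_base pt) _ (fun e => exists f : 'I_d.+3 -> pt,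
  (forall (s : 'I_k), forall a, rint G (rel s) a <->
     frame f /\ rint G (rel s) (fun i => frame_coord f (a i))) /\
  (frame f /\ R (fun i => frame_coord f (e i))))) => [e|]; last first.
  apply: dfn_exn; apply: dfn_and; last first.
    apply: dfn_transport => // i; first by solve_var.
    by left; exists (fun e => e i) => //; exists i.
  apply: dfn_forall_ord => s; apply: dfn_alln; apply: dfn_equiv.
    by apply: dfn_rint => i; solve_var.
  by apply: dfn_transport => // i; solve_var.
split=> [Re|[f [fG [ff Rf]]]].
  (* The standard frame, for which [frame_coord] is the identity. *)
  exists (fun i => if unlift ord0 i is Some j then delta_mx 0 j else 0).
  set f := (fun i => _).
  have f0 : origin f = 0 by rewrite /origin /f unlift_none.
  have f1 : frame_mx f = 1%:M.
    by apply/row_matrixP => j; rewrite rowK rowE mulmx1 f0 subr0 /unit_pt /f liftK.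
  have ff : frame f by rewrite /frame f1 unitmx1.
  have fid x : frame_coord f x = x by rewrite /frame_coord f0 f1 invmx1 mulmx1 subr0.
  have fcomp m (a : 'I_m -> pt) : (fun i => frame_coord f (a i)) = a.
    by apply: funext => i; rewrite fid.
  split=> [s a|]; first by rewrite fcomp; split=> [|[]].
  by split=> //; rewrite (fcomp n (fun i => e i)).
have [|g_aut g_aff gK] := @frame_affine_automorphism f ff.
  move=> r; have [s <-] := rel_onto r => a; rewrite [X in X <-> _]fG.
  by split=> [[]|].
(* [R] holds of the coordinates along [f], and [g] carries these back to the original points. *)
have := Rclosed _ g_aut g_aff _ Rf.
set b := (X in R X); have -> // : b = (fun i : 'I_n => e i).
by apply: funext => i; apply: gK.
Qed.

Theorem concept_equivalencesP n (R : ('I_n -> pt) -> Prop) : concept_equivalences B G R.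
Proof.
have over : definable G n R -> definable_over B R by exact: definable_over_of_definable.
have aut : definable G n R -> forall f, automorphism G f -> closed_under R f.
  by move=> dR f f_aut; apply: (definable_closed f_aut 0 dR).
split; split=> [dR|[R_over_B Rclosed]].
- by split; [apply: over|apply: aut].
- by apply: definable_of_affine_closed => // g g_aut _; apply: Rclosed.
- by split=> [|g g_aut _]; [apply: over|apply: aut].
- exact: definable_of_affine_closed.
Qed.

End FieldToPoints.

End Translation.

(** * The field and ordered-field cases *)

Lemma dfn_ternary (L : sig) (T : zmodType) (S : structure L T) (K : ('I_3 -> T) -> Prop)
    (C : ctx T) (X Y Z : env C -> T) :
  definable S 3 K -> var C X -> var C Y -> var C Z ->
  dfn S (fun e => K (fun i => [:: X e; Y e; Z e]`_i)).
Proof.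
move=> dK XV YV ZV; apply: dfn_definable => // i.
by case: i => -[|[|[|i]]].
Qed.

Section FieldOperations.
Variables (F : fieldType) (d : nat).
Local Notation pt := 'rV[F]_d.+2.
Hypothesis F_gt2 : exists l : F, l != 0 /\ l != 1.
Variables (LG : sig) (G : structure LG pt).
Hypothesis dfn_collinear : forall (C : ctx pt) (x y z : env C -> pt),
  var C x -> var C y -> var C z -> dfn G (fun e => collinear (x e) (y e) (z e)).

Lemma field_fint_definable (g : field_fsym) (C : ctx pt)
    (f : env C -> 'I_d.+3 -> pt) (a : env C -> 'I_(field_fari g) -> pt) (y : env C -> pt) :
  (forall i, var C (fun e => f e i)) -> (forall i, var C (fun e => a e i)) -> var C y ->
  exists2 P, dfn G P & forall e (c : 'I_(field_fari g) -> F), preframe (f e) ->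
    (forall k, a e k = on_axis (f e) (c k)) -> P e <-> y e = on_axis (f e) (field_fint c).
Proof.
move=> fV; case: g a => a aV yV /=.
(* Addition lays off the vector of the first summand at the second. *)
- exists (fun e => a e ord0 - origin (f e) = y e - a e ord_max).
    by apply: dfn_eqvec => //; apply: fV.
  move=> e c _ aE; rewrite !aE /on_axis; split=> [E|->]; last by coordinatewise; ring.
  by rewrite -[LHS](subrK (a e ord_max)) aE -E; coordinatewise; ring.
(* The last axis serves as auxiliary axis; it differs from the first in dimension at least 2. *)
- exists (fun e => product (origin (f e)) (unit_pt (f e) ord0) (unit_pt (f e) ord_max)
    (a e ord0) (a e ord_max) (y e)).
    by apply: dfn_product => //; apply: fV.
  move=> e c pf aE; split=> [[_ [l [m [xE yE ->]]]]|->].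
    move: xE yE; rewrite !aE => /(on_axis_inj pf)-> /(on_axis_inj pf)-> //.
  split; first exact: pf.
  by exists (c ord0), (c ord_max); rewrite !aE.
- exists (fun e => y e = origin (f e)) => [|e c _ _]; last by rewrite /on_axis scale0r addr0.
  by apply: dfn_eq => //; apply: fV.
- exists (fun e => y e = unit_pt (f e) ord0) => [|e c _ _].
    by apply: dfn_eq => //; apply: fV.
  by rewrite /on_axis scale1r addrC subrK.
Qed.

End FieldOperations.

Section Betweenness.
Variables (F : realFieldType) (d : nat).
Local Notation pt := 'rV[F]_d.+2.
Implicit Types p q r : pt.

Definition between p q r : Prop := exists l : F, 0 <= l <= 1 /\ q = p + l *: (r - p).

(** The three cases are the parameter of [q] on the line [pr] lying in, above or below the unit
    interval. Conversely one solves for that parameter, and a vanishing denominator means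
    [r = p]. *)
Lemma collinear_between p q r : collinear p q r <->
  [\/ between p q r, between q r p | between r p q].
Proof.
split=> [[[l qE]|->]|]; last first.
- case=> [[l [_ qE]]|[l [l01 rE]]|[l [l01 pE]]].
  + by left; exists l.
  + have [l1|l1] := eqVneq l 1; first by right; rewrite rE l1; coordinatewise; ring.
    left; exists ((1 - l)^-1); rewrite rE; coordinatewise; field.
    by rewrite subr_eq0 eq_sym.
  + have [l0|l0] := eqVneq l 0; first by right; rewrite pE l0; coordinatewise; ring.
    by left; exists ((l - 1) / l); rewrite pE; coordinatewise; field.
- by constructor 2; exists 1; split; [rewrite ler01 lexx|coordinatewise; ring].
have [l0|l0] := ltP l 0.
  constructor 3; exists (1 - l)^-1.
  have l1 : 0 < 1 - l by lra.
  split; last by rewrite qE; coordinatewise; field; rewrite gt_eqF.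
  by rewrite invr_ge0 ltW //= invf_le1 //; lra.
have [l1|l1] := leP l 1; first by constructor 1; exists l; rewrite l0.
constructor 2; exists ((l - 1) / l).
have l0' : 0 < l by lra.
split; last by rewrite qE; coordinatewise; field; rewrite gt_eqF.
by rewrite ler_pdivlMr // ler_pdivrMr // mul0r mul1r; lra.
Qed.

(** [w] is the axis point of [c - b], and nonnegativity says that it lies on the ray from the origin
    through the unit point, before or beyond that point. *)
Lemma le_between (f : 'I_d.+3 -> pt) (b c : F) : preframe f ->
  b <= c <-> exists w, w - origin f = on_axis f c - on_axis f b /\
    (between (origin f) w (unit_pt f ord0) \/ between (origin f) (unit_pt f ord0) w).
Proof.
move=> pf; have diff w : w - origin f = on_axis f c - on_axis f b <-> w = on_axis f (c - b).
  split=> [E|->]; last by rewrite /on_axis; coordinatewise; ring.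
  by rewrite -[w](subrK (origin f)) E /on_axis; coordinatewise; ring.
split=> [bc|[w [/diff-> bw]]].
  exists (on_axis f (c - b)); split; first exact/diff.
  have [l1|l1] := leP (c - b) 1.
    by left; exists (c - b); rewrite l1 subr_ge0 bc.
  have l0 : 0 < c - b by lra.
  right; exists (c - b)^-1; split; first by rewrite invr_ge0 ltW //= invf_le1 // ltW.
  by rewrite /on_axis; coordinatewise; field; rewrite gt_eqF.
case: bw => -[l [/andP[l0 l1]]] => [/(on_axis_inj pf) E|E]; first by lra.
(* Thus [l * (c - b) = 1] with [l] nonnegative, which excludes a negative [c - b]. *)
have {}E : on_axis f 1 = on_axis f (l * (c - b)).
  transitivity (unit_pt f ord0); first by rewrite /on_axis; coordinatewise; ring.
  by rewrite E /on_axis; coordinatewise; ring.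
move/(on_axis_inj pf): E => E; rewrite leNgt; apply/negP => cb.
have : l * (c - b) <= 0 by rewrite pmulr_rle0; nra.
by rewrite -E; lra.
Qed.

End Betweenness.

Theorem theorem1 :
  (* case 1: F an ordered field (coordinate geometries defined via Bw) *)
  (forall (F : realFieldType) (d : nat), (2 <= d)%N ->
   forall (LG : sig) (G : structure LG 'rV[F]_d),
   FFD (ofield_struct F) (@Bw F d) G ->
   forall (n : nat), (1 <= n)%N ->
   forall R : ('I_n -> 'rV[F]_d) -> Prop,
   concept_equivalences (ofield_struct F) G R) /\
  (* case 2: F a field with more than two elements (defined via Col) *)
  (forall (F : fieldType), (exists x : F, x != 0 /\ x != 1) ->
   forall (d : nat), (2 <= d)%N ->
   forall (LG : sig) (G : structure LG 'rV[F]_d),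
   FFD (field_struct F) (@Col F d) G ->
   forall (n : nat), (1 <= n)%N ->
   forall R : ('I_n -> 'rV[F]_d) -> Prop,
   concept_equivalences (field_struct F) G R).
Proof.
split.
- move=> F [|[|d]] // _ LG G [[G_rel dBw] G_over_B G_fin] n _ R.
  have dfn_between (C : ctx 'rV[F]_d.+2) (x y z : env C -> 'rV[F]_d.+2) :
      var C x -> var C y -> var C z -> dfn G (fun e => between (x e) (y e) (z e)).
    move=> xV yV zV; apply: dfn_iff (dfn_ternary dBw xV yV zV) => e.
    by rewrite /Bw /= inordK.
  have dfn_coll (C : ctx 'rV[F]_d.+2) (x y z : env C -> 'rV[F]_d.+2) :
      var C x -> var C y -> var C z -> dfn G (fun e => collinear (x e) (y e) (z e)).
    move=> xV yV zV; apply: dfn_iff (fun e => collinear_between _ _ _) _.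
    by apply: dfn_or3; apply: dfn_between.
  have F_gt2 : exists l : F, l != 0 /\ l != 1.
    by exists 2; split; apply/eqP; lra.
  apply: concept_equivalencesP => //; first by move=> g; apply: field_fint_definable.
  move=> [] C f a fV aV; exists (fun e => exists w,
     w - origin (f e) = a e ord_max - a e ord0 /\
     (between (origin (f e)) w (unit_pt (f e) ord0) \/
      between (origin (f e)) (unit_pt (f e) ord0) w)).
    apply: dfn_ex; apply: dfn_and.
      by apply: (dfn_eqvec F_gt2 dfn_coll); solve_var.
    by apply: dfn_or; apply: dfn_between; solve_var.
  by move=> e c pf aE; rewrite (aE ord0) (aE ord_max); apply: iff_sym; apply: le_between.
- move=> F F_gt2 [|[|d]] // _ LG G [[G_rel dCol] G_over_B G_fin] n _ R.
  have dfn_coll (C : ctx 'rV[F]_d.+2) (x y z : env C -> 'rV[F]_d.+2) :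
      var C x -> var C y -> var C z -> dfn G (fun e => collinear (x e) (y e) (z e)).
    move=> xV yV zV; apply: dfn_iff (dfn_ternary dCol xV yV zV) => e.
    by rewrite /Col /= inordK.
  apply: concept_equivalencesP => //; move=> g.
  exact: field_fint_definable.
Qed.
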